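(* Let $T=\sum_{j=1}^kQ_jD^j$ be a degenerate exactly-solvable operator of order $k$ such that $\deg Q_j\leq j_0$ for all $j>j_0$, and in particular $\deg Q_k=j_0$, where $j_0$ is the largest $j$ such that $\deg Q_j=j$. Then $\lim_{n\to\infty}\frac{r_n}{n^{\gamma}}=\infty$ for any real $\gamma<1$.
   Context: Here $D=d/dz$. A degenerate exactly-solvable operator of order $k$ is a linear differential operator $T=\sum_{j=1}^{k}Q_jD^j$ with polynomial coefficients $Q_j\in\mathbb{C}[z]$, $Q_k\not\equiv 0$, such that $\deg Q_j\leq j$ for all $j$, with equality for at least one $j$, and $\deg Q_k<k$. For all sufficiently large integers $n$ there exist a unique constant $\lambda_n$ and a unique monic polynomial $p_n$ of degree $n$ with $T(p_n)=\lambda_n p_n$. For such $n$, $r_n=\max\{|z|:p_n(z)=0\}$. Conditions on $\deg Q_j$ refer only to indices $j$ for which $Q_j$ is not identically zero. *)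

(* Defs.v *)
(* The complex field is R[i] over R : realType. *)
From mathcomp Require Import all_boot all_order all_algebra.
From mathcomp Require Import all_classical all_reals all_analysis.
From mathcomp Require Import complex.

Set Implicit Arguments.
Unset Strict Implicit.
Unset Printing Implicit Defensive.

Import Order.TTheory GRing.Theory Num.Theory.
Import numFieldNormedType.Exports.

Local Open Scope classical_set_scope.
Local Open Scope ring_scope.

(* An operator of order k is given by its coefficients Q 1, ..., Q k; the
   values of Q at other indices are never used. *)
Definition diffop (R : realType) (k : nat) (Q : nat -> {poly R[i]})
    (p : {poly R[i]}) : {poly R[i]} :=
  \sum_(1 <= j < k.+1) Q j * p^`(j).

(* Since size 0 = 0, [size q <= d.+1] means "q = 0 or deg q <= d", and
   [size q = d.+1] means "q != 0 and deg q = d". *)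
Definition degenerate_exactly_solvable (R : realType) (k : nat)
    (Q : nat -> {poly R[i]}) : Prop :=
  [/\ Q k != 0,
      (forall j, (1 <= j <= k)%N -> (size (Q j) <= j.+1)%N),
      (exists2 j, (1 <= j <= k)%N & size (Q j) = j.+1) &
      (size (Q k) <= k)%N].

Definition is_largest_full_degree (R : realType) (k : nat)
    (Q : nat -> {poly R[i]}) (j0 : nat) : Prop :=
  [/\ (1 <= j0 <= k)%N,
      size (Q j0) = j0.+1 &
      forall j, (1 <= j <= k)%N -> size (Q j) = j.+1 -> (j <= j0)%N].

Definition is_eigenpoly (R : realType) (k : nat) (Q : nat -> {poly R[i]})
    (n : nat) (lambda : R[i]) (p : {poly R[i]}) : Prop :=
  [/\ p \is monic, size p = n.+1 & diffop k Q p = lambda *: p].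

(* For a degenerate exactly-solvable operator there is exactly one such
   polynomial for every large n; the default 0 only matters for the finitely
   many n for which none exists. *)
Definition eigenpoly (R : realType) (k : nat) (Q : nat -> {poly R[i]})
    (n : nat) : {poly R[i]} :=
  xget 0 [set p | exists lambda : R[i], is_eigenpoly k Q n lambda p].

(* The roots of a polynomial of positive degree form a finite nonempty set, so
   this supremum is the maximum of their moduli. *)
Definition root_radius (R : realType) (p : {poly R[i]}) : R :=
  sup [set ComplexField.Normc.normc z | z in [set z : R[i] | root p z]].

Definition largest_root_modulus (R : realType) (k : nat)
    (Q : nat -> {poly R[i]}) (n : nat) : R :=
  root_radius (eigenpoly k Q n).

(* Main.v *)
(* In fact r_n >= c n for some c > 0.  If all roots of p lie in |z| <= r, the
   Gauss-Lucas theorem and the logarithmic derivative give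
   (deg p - j) |p^(j)(z)| <= (|z| + r) |p^(j+1)(z)| for |z| > r.  If r were at
   most e n / 6, then at |z| = e n / 3 this would give
   |p^(j)(z)| <= e^(k-j) |p^(k)(z)| for j <= k.  As every Q_j is O(|z|^j0) while
   Q_k has exact order |z|^j0, and as the eigenvalue is O(n^j0), the term
   Q_k p^(k) would dominate the eigenvalue equation once e is small.
   Eigenpolynomials exist for large n because T is triangular in the monomial
   basis and its n-th diagonal entry then differs from all the earlier ones. *)
Require Import Defs.
From mathcomp Require Import all_boot all_order all_algebra.
From mathcomp Require Import all_classical all_reals all_analysis.
From mathcomp Require Import complex ring lra zify.

Import Order.TTheory GRing.Theory Num.Theory.
Import numFieldNormedType.Exports.

Local Open Scope classical_set_scope.
Local Open Scope ring_scope.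

Local Notation normc := ComplexField.Normc.normc.
Local Notation Re := complex.Re.
Local Notation Im := complex.Im.

(** * Modulus of complex numbers *)

Lemma normc_ge0 (R : realType) (z : R[i]) : 0 <= normc z.
Proof. by case: z => x y /=; rewrite sqrtr_ge0. Qed.

Lemma normc_real (R : realType) (x : R) : 0 <= x -> normc x%:C%C = x.
Proof. by move=> x0; rewrite /= expr0n /= addr0 sqrtr_sqr ger0_norm. Qed.

Lemma normc_nat (R : realType) (n : nat) : normc (n%:R : R[i]) = n%:R.
Proof. by rewrite -(rmorph_nat (real_complex R)) normc_real. Qed.

Lemma normcX (R : realType) (z : R[i]) n : normc (z ^+ n) = normc z ^+ n.
Proof.
elim: n => [|n IH]; first by rewrite !expr0 ComplexField.Normc.normc1.
by rewrite !exprS ComplexField.Normc.normcM IH.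
Qed.

Lemma normc_eq0 (R : realType) (z : R[i]) : (normc z == 0) = (z == 0).
Proof.
apply/eqP/eqP => [/ComplexField.Normc.eq0_normc //|->].
by rewrite ComplexField.Normc.normc0.
Qed.

Lemma normc_sum (R : realType) (I : Type) (s : seq I) (P : pred I)
  (F : I -> R[i]) :
  normc (\sum_(i <- s | P i) F i) <= \sum_(i <- s | P i) normc (F i).
Proof.
elim/big_ind2: _ => //; first by rewrite ComplexField.Normc.normc0.
move=> a x b y xa yb; apply: le_trans (le_normcD _ _) _; exact: lerD.
Qed.

Lemma Re_le_normc (R : realType) (z : R[i]) : Re z <= normc z.
Proof.
by apply: le_trans (ler_norm _) _; rewrite -lecR; exact: normc_ge_Re.
Qed.

(** * Logarithmic derivative and Gauss-Lucas for a disc centred at 0 *)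

(* The map w |-> 1 / (1 - w) sends the disc |w| <= s < 1 into the half-plane
   Re >= 1 / (1 + s); take w = a / z and s = r / |z|. *)
Lemma Re_div_sub_ge (R : realType) (z a : R[i]) (r : R) :
  normc a <= r -> r < normc z ->
  normc z / (normc z + r) <= Re (z / (z - a)).
Proof.
move=> ar rz; have a0 := normc_ge0 _ a.
have zr : 0 < normc z + r by lra.
have za : 0 < normc (z - a).
  have := le_normcD (z - a) a; rewrite subrK; lra.
have zE : normc z ^+ 2 = (Re z) ^+ 2 + (Im z) ^+ 2.
  by case: (z) => x y /=; rewrite sqr_sqrtr // addr_ge0 ?sqr_ge0.
have aE : normc a ^+ 2 = (Re a) ^+ 2 + (Im a) ^+ 2.
  by case: (a) => x y /=; rewrite sqr_sqrtr // addr_ge0 ?sqr_ge0.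
have dE : normc (z - a) ^+ 2 = (Re z - Re a) ^+ 2 + (Im z - Im a) ^+ 2.
  by case: (z) (a) => x y [b c] /=; rewrite sqr_sqrtr // addr_ge0 ?sqr_ge0.
have -> : Re (z / (z - a)) =
    (Re z * (Re z - Re a) + Im z * (Im z - Im a)) / normc (z - a) ^+ 2.
  rewrite dE; case: (z) (a) => x y [b c] /=; ring.
rewrite ler_pdivrMr // mulrAC ler_pdivlMr ?exprn_gt0 //.
move: zE aE dE; set x := Re z; set y := Im z; set b := Re a; set c := Im a.
set Z := normc z in ar rz zr *; set A := normc a in ar a0 *.
move=> zE aE dE.
(* Cauchy-Schwarz, by Lagrange's identity with remainder [(x * c - y * b) ^+ 2]. *)
have CS : `|x * b + y * c| <= Z * r.
  rewrite -(@ler_pXn2r _ 2) ?nnegrE ?normr_ge0 //; last by apply: mulr_ge0; lra.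
  rewrite real_normK ?num_real // exprMn.
  apply: (@le_trans _ _ (Z ^+ 2 * A ^+ 2)).
    rewrite zE aE; have := sqr_ge0 (x * c - y * b); nra.
  by rewrite ler_wpM2l ?sqr_ge0 // lerXn2r ?nnegrE //; lra.
have A2 : A ^+ 2 <= r ^+ 2 by rewrite lerXn2r ?nnegrE //; lra.
have {CS} CS : 0 <= Z * r + (x * b + y * c).
  by move: CS; rewrite ler_norml => /andP[]; lra.
(* The two sides of the goal differ by exactly the sum of the nonnegative quantities in [H] and
   [K]. *)
have H := mulr_ge0 (ltW (ltac:(lra) : 0 < Z - r)) CS.
have K := mulr_ge0 (ltW (ltac:(lra) : 0 < Z))
  (ltac:(lra) : 0 <= r ^+ 2 - A ^+ 2).
rewrite dE; nra.
Qed.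

(** By the product rule, [z * f' / f] is the sum of [z / (z - a)] over the listed roots, and
    [Re_div_sub_ge] bounds each term. Non-vanishing of [f] at [z] is carried along because the
    inductive step divides by it. *)
Lemma Re_logderiv_prod_ge (R : realType) (s : seq R[i]) (z : R[i]) (r : R) :
  (forall a, a \in s -> normc a <= r) -> r < normc z ->
  let f := \prod_(a <- s) ('X - a%:P) in
  f.[z] != 0 /\
  (size s)%:R * (normc z / (normc z + r)) <= Re (z * (f^`().[z] / f.[z])).
Proof.
move=> sr rz; elim: s sr => [|a s IH] sr /=.
  rewrite big_nil -polyC1 derivC !hornerE oner_eq0.
  by split=> //=; rewrite mulr0 mul0r.
have [|f0 IHs] := IH.
  by move=> b bs; apply: sr; rewrite inE bs orbT.
rewrite big_cons; move: f0 IHs; set f := \prod_(_ <- s) _ => f0 IHs.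
have ar : normc a <= r by apply: sr; rewrite mem_head.
have za : z - a != 0.
  rewrite subr_eq0; apply: contraTneq ar => <-; by rewrite -ltNge.
split; first by rewrite !hornerE mulf_neq0.
have -> : z * ((('X - a%:P) * f)^`().[z] / (('X - a%:P) * f).[z]) =
    z / (z - a) + z * (f^`().[z] / f.[z]).
  rewrite derivM derivXsubC mul1r !(hornerXsubC, hornerM, hornerD).
  by field; rewrite za f0.
rewrite raddfD /= -natr1 mulrDl mul1r addrC lerD //.
exact: Re_div_sub_ge.
Qed.

(** [f] splits into linear factors, so [z * f' / f] has real part at least
    [deg f * |z| / (|z| + r)]; its modulus is no smaller, and [|z|] cancels. *)
Lemma deriv_lower_bound (R : realType) (f : {poly R[i]}) (z : R[i]) (r : R) :
  0 <= r -> (forall a, root f a -> normc a <= r) -> r < normc z ->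
  (size f).-1%:R * normc f.[z] <= (normc z + r) * normc f^`().[z].
Proof.
move=> r0 fr rz.
have [->|f0] := eqVneq f 0.
  by rewrite size_poly0 mul0r mulr_ge0 ?normc_ge0 // addr_ge0 ?normc_ge0.
have [s fE] := closed_field_poly_normal f.
have c0 : lead_coef f != 0 by rewrite lead_coef_eq0.
have sr a : a \in s -> normc a <= r.
  by move=> sa; apply: fr; rewrite fE rootZ // root_prod_XsubC.
have := Re_logderiv_prod_ge R s z r sr rz.
rewrite fE derivZ size_scale // size_prod_XsubC /= !hornerZ.
set g := \prod_(_ <- s) _ => -[g0 H].
rewrite !ComplexField.Normc.normcM [leRHS]mulrCA [leLHS]mulrCA.
rewrite ler_wpM2l ?normc_ge0 //.
have z0 : 0 < normc z by exact: le_lt_trans rz.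
have gz : 0 < normc g.[z] by rewrite lt_def normc_eq0 g0 normc_ge0.
have := le_trans H (Re_le_normc _ _).
rewrite !ComplexField.Normc.normcM ComplexField.Normc.normcV.
rewrite mulrCA ler_pM2l // ler_pdivlMr // mulrAC ler_pdivrMr ?ltr_wpDr //.
by rewrite [X in _ -> _ <= X]mulrC.
Qed.

(** At a root of [f'] outside the disc, [deriv_lower_bound] would bound a positive number by 0. *)
Lemma Gauss_Lucas_disc (R : realType) (f : {poly R[i]}) (r : R) :
  0 <= r -> (1 < size f)%N -> (forall a, root f a -> normc a <= r) ->
  forall a, root f^`() a -> normc a <= r.
Proof.
move=> r0 sf fr a /eqP fa; rewrite leNgt; apply/negP => ra.
have := deriv_lower_bound R f a r r0 fr ra.
rewrite fa ComplexField.Normc.normc0 mulr0 leNgt mulr_gt0 //.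
  by rewrite ltr0n; case: (size f) sf => [|[]].
rewrite lt_def normc_ge0 andbT normc_eq0; apply: contraL ra => fa0.
by rewrite -leNgt fr.
Qed.

(** * Comparison of successive derivatives *)

Lemma size_derivn_char0 (F : numDomainType) (p : {poly F}) (n j : nat) :
  size p = n.+1 -> (j <= n)%N -> size p^`(j) = (n - j).+1.
Proof.
move=> pn jn; apply/eqP; rewrite eqn_leq; apply/andP; split.
  apply/leq_sizeP => i ni; rewrite coef_derivn nth_default ?mul0rn //.
  by rewrite pn; lia.
rewrite ltnNge; apply/negP => /leq_sizeP /(_ _ (leqnn _)) /eqP.
rewrite coef_derivn subnKC // mulrn_eq0 eqn0Ngt ffact_gt0 jn /=.
have : lead_coef p != 0 by rewrite lead_coef_eq0 -size_poly_eq0 pn.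
by rewrite lead_coefE pn => /negPf ->.
Qed.

(** Iterated Gauss-Lucas keeps the roots of the [j]-th derivative in the disc, so
    [deriv_lower_bound] applies to it in degree [n - j]. *)
Lemma derivn_lower_bound (R : realType) (p : {poly R[i]}) (z : R[i]) (r : R)
  (n j : nat) :
  0 <= r -> (forall a, root p a -> normc a <= r) -> r < normc z ->
  size p = n.+1 -> (j <= n)%N ->
  (n - j)%:R * normc p^`(j).[z] <= (normc z + r) * normc p^`(j.+1).[z].
Proof.
move=> r0 pr rz pn jn.
have jr : forall a, root p^`(j) a -> normc a <= r.
  elim: j jn => [|j IH] jn a; first by rewrite derivn0; exact: pr.
  rewrite derivnS; apply: Gauss_Lucas_disc => //; last exact: IH (ltnW jn).
  by rewrite (size_derivn_char0 _ _ n) ?ltnS ?subn_gt0 // ltnW.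
have := deriv_lower_bound R p^`(j) z r r0 jr rz.
by rewrite (size_derivn_char0 _ _ n) // -derivnS.
Qed.

(** Going down from [k], each step costs a factor [(|z| + r) / (n - j)], at most [e] because
    [n - k <= n - j]. *)
Lemma derivn_geometric_bound (R : realType) (p : {poly R[i]}) (z : R[i])
  (r e : R) (n k j : nat) :
  0 <= r -> (forall a, root p a -> normc a <= r) -> r < normc z ->
  size p = n.+1 -> (k < n)%N -> (j <= k)%N ->
  normc z + r <= e * (n - k)%:R ->
  normc p^`(j).[z] <= e ^+ (k - j) * normc p^`(k).[z].
Proof.
move=> r0 pr rz pn kn jk ze.
have e0 : 0 <= e.
  rewrite -(@pmulr_lge0 _ (n - k)%:R) ?ltr0n ?subn_gt0 //.
  apply: le_trans ze; rewrite addr_ge0 ?normc_ge0 //.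
have nk0 : 0 < (n - k)%:R :> R by rewrite ltr0n subn_gt0.
have [d kd] : {d | (k - j = d)%N} by exists (k - j)%N.
rewrite kd; elim: d j jk kd => [|d IH] j jk kd.
  by rewrite expr0 mul1r (_ : j = k) //; lia.
have {}IH := IH j.+1 ltac:(lia) ltac:(lia).
rewrite exprS -mulrA; apply: le_trans (ler_wpM2l e0 IH).
have H := derivn_lower_bound R p z r n j r0 pr rz pn ltac:(lia).
rewrite -(ler_pM2l nk0); apply: le_trans (le_trans H _).
  by rewrite ler_wpM2r ?normc_ge0 // ler_nat; lia.
by rewrite mulrA [_ * e]mulrC ler_wpM2r ?normc_ge0.
Qed.

(** * Growth of a polynomial at large modulus *)

Definition coef_norm (R : realType) (q : {poly R[i]}) : R :=
  \sum_(i < size q) normc q`_i.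

Lemma coef_norm_ge0 (R : realType) (q : {poly R[i]}) : 0 <= coef_norm R q.
Proof. by apply: sumr_ge0 => i _; apply: normc_ge0. Qed.

Lemma horner_le_coef_norm (R : realType) (q : {poly R[i]}) (d : nat)
  (z : R[i]) :
  (size q <= d.+1)%N -> 1 <= normc z ->
  normc q.[z] <= coef_norm R q * normc z ^+ d.
Proof.
move=> qd z1; rewrite horner_coef mulr_suml.
apply: le_trans (normc_sum _ _ _ _ _) _; apply: ler_sum => i _.
rewrite ComplexField.Normc.normcM normcX ler_wpM2l ?normc_ge0 //.
by rewrite ler_weXn2l // -ltnS (leq_trans (ltn_ord i)).
Qed.

Lemma horner_ge_lead_coef (R : realType) (q : {poly R[i]}) (d : nat) :
  size q = d.+1 ->
  exists2 M : R, 1 <= M & forall z, M <= normc z ->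
    normc (lead_coef q) / 2 * normc z ^+ d <= normc q.[z].
Proof.
move=> qd; pose q' := q - lead_coef q *: 'X^d.
have q'd : (size q' <= d)%N.
  apply/leq_sizeP => i; rewrite leq_eqVlt coefB coefZ coefXn.
  case/orP => [/eqP <-|di]; first by rewrite eqxx mulr1 lead_coefE qd subrr.
  by rewrite gtn_eqF // mulr0 subr0 nth_default // qd.
have l0 : 0 < normc (lead_coef q).
  by rewrite lt_def normc_eq0 normc_ge0 lead_coef_eq0 -size_poly_eq0 qd.
set l := normc (lead_coef q) in l0 *.
(* The summand 1 gives [1 <= |z|]; the quotient makes [q'] at most half the leading term. *)
exists (1 + coef_norm R q' / (l / 2)).
  by rewrite lerDl divr_ge0 ?coef_norm_ge0 //; lra.
move=> z Mz; have q'0 := coef_norm_ge0 R q'.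
have z1 : 1 <= normc z.
  by apply: le_trans Mz; rewrite lerDl divr_ge0 //; lra.
have q'z : normc q'.[z] <= l / 2 * normc z ^+ d.
  have H : coef_norm R q' <= l / 2 * normc z.
    by rewrite mulrC -ler_pdivrMr; [lra|lra].
  move: (d) q'd => -[|e] q'e.
    have -> : q' = 0 by apply/eqP; rewrite -size_poly_eq0 -leqn0.
    by rewrite horner0 ComplexField.Normc.normc0 mulr_ge0 //; lra.
  apply: le_trans (horner_le_coef_norm R q' e z q'e z1) _.
  rewrite exprS mulrA ler_wpM2r // exprn_ge0 //; lra.
have qE : lead_coef q * z ^+ d = q.[z] + - q'.[z].
  by rewrite /q' hornerD hornerN hornerZ hornerXn opprB addrC subrK.
have : l * normc z ^+ d <= normc q.[z] + normc q'.[z].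
  rewrite -normcX -ComplexField.Normc.normcM qE.
  by rewrite -(normcN q'.[z]) le_normcD.
have -> : l = l / 2 + l / 2 by lra.
rewrite mulrDl; lra.
Qed.

(** * Triangularity and existence of eigenpolynomials *)

(** The [n]-th diagonal entry of the operator in the monomial basis, hence the eigenvalue in degree
    [n]. *)
Definition diag_coef (R : realType) (k : nat) (Q : nat -> {poly R[i]})
    (n : nat) : R[i] :=
  \sum_(1 <= j < k.+1) (Q j)`_j * (n ^_ j)%:R.

Lemma coefM_top (F : nzRingType) (a b : {poly F}) (i j : nat) :
  (size a <= i.+1)%N -> (size b <= j.+1)%N -> (a * b)`_(i + j) = a`_i * b`_j.
Proof.
move=> ai bj; rewrite coefM.
have ij : (i < (i + j).+1)%N by lia.
rewrite (bigD1 (Ordinal ij)) //= addKn big1 ?addr0 // => l /eqP li.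
have [il|il] := ltnP i l; first by rewrite nth_default ?mul0r // (leq_trans ai).
rewrite [b`__]nth_default ?mulr0 //; apply: leq_trans bj _.
have : l != i :> nat by apply/eqP => le; apply: li; exact/val_inj.
by move: il; have := ltn_ord l; lia.
Qed.

Lemma size_derivn_le (F : nzRingType) (p : {poly F}) (m j : nat) :
  (size p <= m)%N -> (size p^`(j) <= m - j)%N.
Proof.
move=> pm; apply/leq_sizeP => i mi.
by rewrite coef_derivn nth_default ?mul0rn // (leq_trans pm) //; lia.
Qed.

(** Multiplication by [Q j] restores at most the [j] degrees lost by differentiation, so only top
    coefficients meet in degree [n]. For [j > n] both the derivative and the falling factorial
    vanish. *)
Lemma coef_diffop_top (R : realType) (k : nat) (Q : nat -> {poly R[i]})
  (p : {poly R[i]}) (n : nat) :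
  (forall j, (1 <= j <= k)%N -> (size (Q j) <= j.+1)%N) ->
  (size p <= n.+1)%N -> (diffop k Q p)`_n = diag_coef R k Q n * p`_n.
Proof.
move=> HQ pn; rewrite /diffop coef_sum mulr_suml.
apply: eq_big_nat => j; rewrite ltnS => jk.
have [nj|jn] := ltnP n j.
  rewrite ffact_small // mulr0 mul0r [p^`(j)](_ : _ = 0) ?mulr0 ?coef0 //.
  apply/eqP; rewrite -size_poly_eq0 -leqn0.
  by have := size_derivn_le _ _ n.+1 j pn; rewrite (_ : n.+1 - j = 0)%N //; lia.
rewrite -{1}(subnKC jn) coefM_top ?HQ //; last first.
  by rewrite -subSn // size_derivn_le.
by rewrite coef_derivn subnKC // -mulrA mulr_natl.
Qed.

Lemma size_diffop_le (R : realType) (k : nat) (Q : nat -> {poly R[i]})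
  (p : {poly R[i]}) (m : nat) :
  (forall j, (1 <= j <= k)%N -> (size (Q j) <= j.+1)%N) ->
  (size p <= m)%N -> (size (diffop k Q p) <= m)%N.
Proof.
move=> HQ pm; rewrite /diffop big_nat_cond.
elim/big_ind: _ => [|a b am bm|j]; first by rewrite size_poly0.
  by rewrite (leq_trans (size_polyD _ _)) // geq_max am.
rewrite ltnS andbT => jk.
have [->|d0] := eqVneq p^`(j) 0; first by rewrite mulr0 size_poly0.
rewrite (leq_trans (size_polyMleq _ _)) //.
have dm : (size p^`(j) <= m - j)%N by exact: size_derivn_le.
have := HQ j jk; move: dm.
by rewrite -size_poly_gt0 in d0; move: d0; lia.
Qed.

Lemma diffopD (R : realType) (k : nat) (Q : nat -> {poly R[i]})
  (p q : {poly R[i]}) :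
  diffop k Q (p + q) = diffop k Q p + diffop k Q q.
Proof.
by rewrite /diffop -big_split /=; apply: eq_bigr => j _; rewrite derivnD mulrDr.
Qed.

(** Back substitution: a multiple [f0] of the top monomial clears the leading coefficient of [g],
    its diagonal entry differing from [l], and induction handles the remainder. *)
Lemma diffop_shift_surj (R : realType) (k : nat) (Q : nat -> {poly R[i]})
  (l : R[i]) (m : nat) (g : {poly R[i]}) :
  (forall j, (1 <= j <= k)%N -> (size (Q j) <= j.+1)%N) ->
  (forall i, (i < m)%N -> diag_coef R k Q i != l) -> (size g <= m)%N ->
  exists2 f : {poly R[i]}, (size f <= m)%N & diffop k Q f - l *: f = g.
Proof.
move=> HQ; elim: m g => [|m IH] g hl.
  rewrite leqn0 size_poly_eq0 => /eqP ->; exists 0; first by rewrite size_poly0.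
  rewrite scaler0 subr0 /diffop big1 // => j _.
  by rewrite -[0 in LHS](scale0r 0) derivnZ scale0r mulr0.
move=> gm.
pose f0 : {poly R[i]} := (g`_m / (diag_coef R k Q m - l)) *: 'X^m.
have dl : diag_coef R k Q m - l != 0 by rewrite subr_eq0 hl.
have f0m : (size f0 <= m.+1)%N.
  by rewrite (leq_trans (size_scale_leq _ _)) // size_polyXn.
have [|f fm fE] := IH (g - (diffop k Q f0 - l *: f0))
  (fun i im => hl i (ltnW im)).
  apply/leq_sizeP => i; rewrite leq_eqVlt => /orP[/eqP <-|mi].
    rewrite !coefB coef_diffop_top // [(l *: f0)`_m]coefZ -mulrBl.
    by rewrite coefZ coefXn eqxx mulr1 mulrC divfK // subrr.
  rewrite !coefB coefZ !nth_default ?mulr0 ?subrr ?subr0 //.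
  - exact: leq_trans f0m mi.
  - exact: leq_trans (size_diffop_le _ _ _ _ _ HQ f0m) mi.
  - exact: leq_trans gm mi.
exists (f + f0).
  rewrite (leq_trans (size_polyD _ _)) // geq_max f0m andbT.
  exact: leq_trans fm (leqnSn m).
rewrite diffopD scalerDr opprD addrACA fE subrK //.
Qed.

(** With [l] the diagonal entry, [T - l] sends ['X^n] below degree [n], where it is surjective;
    subtracting a preimage of lower degree leaves an eigenpolynomial. *)
Lemma eigenpoly_exists (R : realType) (k : nat) (Q : nat -> {poly R[i]})
  (n : nat) :
  (forall j, (1 <= j <= k)%N -> (size (Q j) <= j.+1)%N) ->
  (forall m, (m < n)%N -> diag_coef R k Q m != diag_coef R k Q n) ->
  exists (p : {poly R[i]}) (l : R[i]), is_eigenpoly k Q n l p.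
Proof.
move=> HQ hl; set l := diag_coef R k Q n in hl.
have [|f fn fE] := diffop_shift_surj _ _ _ l n
  (diffop k Q 'X^n - l *: 'X^n) HQ hl.
  apply/leq_sizeP => i; rewrite leq_eqVlt => /orP[/eqP <-|ni].
    by rewrite coefB coef_diffop_top ?size_polyXn // coefZ subrr.
  rewrite coefB coefZ !nth_default ?mulr0 ?subrr //.
  - by rewrite size_polyXn.
  - by rewrite (leq_trans (size_diffop_le _ _ _ 'X^n n.+1 HQ _)) ?size_polyXn.
have fN : (size (- f) < size ('X^n : {poly R[i]}))%N.
  by rewrite size_polyN size_polyXn ltnS.
exists ('X^n - f), l; split.
- by rewrite monicE lead_coefDl // lead_coefXn.
- by rewrite size_polyDl // size_polyXn.
apply/eqP; rewrite -subr_eq0; apply/eqP.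
have -> : diffop k Q ('X^n - f) = diffop k Q 'X^n - diffop k Q f.
  by apply/eqP; rewrite eq_sym subr_eq -diffopD subrK.
by rewrite scalerBr opprB (addrC (l *: f)) addrACA -fE
  (addrC (- _)) -[l *: f - _]opprB subrr.
Qed.

Lemma eigenvalueE (R : realType) (k : nat) (Q : nat -> {poly R[i]})
  (n : nat) (l : R[i]) (p : {poly R[i]}) :
  (forall j, (1 <= j <= k)%N -> (size (Q j) <= j.+1)%N) ->
  is_eigenpoly k Q n l p -> l = diag_coef R k Q n.
Proof.
move=> HQ [/monicP p1 pn /(congr1 (fun q : {poly R[i]} => q`_n))].
rewrite coef_diffop_top ?pn // coefZ.
by move: p1; rewrite lead_coefE pn /= => ->; rewrite !mulr1.
Qed.

(** * Distinctness of the diagonal entries *)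

Lemma natr_ffactS (R : numDomainType) (n j : nat) :
  (n ^_ j.+1)%:R = (n ^_ j)%:R * (n%:R - j%:R) :> R.
Proof.
rewrite ffactnSr natrM; have [jn|nj] := leqP j n; first by rewrite natrB.
by rewrite ffact_small // !mul0r.
Qed.

(** The difference of two diagonal entries is the sum of these numbers weighted by the degree-[j]
    coefficients of the [Q j]. *)
Definition ffact_diff (R : realType) (n m j : nat) : R :=
  (n ^_ j)%:R - (m ^_ j)%:R.

(** The right side exceeds the left by [m ^_ j * (n - m)]. *)
Lemma ffact_diffS (R : realType) (n m j : nat) : (m <= n)%N ->
  (n%:R - j%:R) * ffact_diff R n m j <= ffact_diff R n m j.+1.
Proof.
move=> mn; rewrite /ffact_diff !natr_ffactS.
have : 0 <= (m ^_ j)%:R * (n%:R - m%:R) :> R.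
  by rewrite mulr_ge0 // subr_ge0 ler_nat.
nra.
Qed.

Lemma ffact_diff_gt0 (R : realType) (n m j : nat) :
  (m < n)%N -> (j < n)%N -> 0 < ffact_diff R n m j.+1.
Proof.
move=> mn; elim: j => [|j IH] jn.
  by rewrite /ffact_diff !ffactn1 subr_gt0 ltr_nat.
apply: lt_le_trans (ffact_diffS _ _ _ _ (ltnW mn)).
by rewrite mulr_gt0 ?IH ?(ltnW jn) // subr_gt0 ltr_nat.
Qed.

(** The first step of [ffact_diffS] from [j] gives the factor [n - j], more than [n - i]; the later
    factors are at least 1. *)
Lemma ffact_diff_dominates (R : realType) (n m i j : nat) :
  (m < n)%N -> (0 < j)%N -> (j < i)%N -> (i <= n)%N ->
  (n%:R - i%:R) * ffact_diff R n m j <= ffact_diff R n m i.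
Proof.
move=> mn j0; elim: i => // i IH; rewrite ltnS leq_eqVlt => ji iN.
have dj : 0 < ffact_diff R n m j.
  by case: (j) j0 ji => // j' _ ji; apply: ffact_diff_gt0; lia.
case/orP: ji => [/eqP ji|ji].
  rewrite -{}ji in iN *; apply: le_trans (ffact_diffS _ _ _ _ (ltnW mn)).
  by rewrite ler_wpM2r ?(ltW dj) // -natr1; lra.
have {}IH := IH ji (ltnW iN).
have ni : i%:R + 1 <= n%:R :> R by rewrite natr1 ler_nat.
have di : 0 <= ffact_diff R n m i.
  by apply: le_trans IH; rewrite mulr_ge0 ?(ltW dj) //; lra.
apply: le_trans (ffact_diffS _ _ _ _ (ltnW mn)).
rewrite -natr1; nra.
Qed.

(** If the entries agreed, the [j0] term would cancel the terms with [j < j0], each smaller by a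
    factor [n - j0] up to its coefficient. The condition on [n] is free of [m], so all [m < n] are
    covered at once. *)
Lemma diag_coef_neq (R : realType) (k : nat) (Q : nat -> {poly R[i]})
  (j0 n m : nat) :
  (1 <= j0 <= k)%N -> (forall j, (j0 < j <= k)%N -> (Q j)`_j = 0) ->
  (j0 <= n)%N ->
  \sum_(1 <= j < k.+1) normc (Q j)`_j < (n%:R - j0%:R) * normc (Q j0)`_j0 ->
  (m < n)%N -> diag_coef R k Q m != diag_coef R k Q n.
Proof.
move=> j0k Qj jn Ln mn; apply/eqP => E.
have D0 : \sum_(1 <= j < k.+1) (Q j)`_j * (ffact_diff R n m j)%:C%C = 0.
  transitivity (diag_coef R k Q n - diag_coef R k Q m); last by rewrite E subrr.
  rewrite /diag_coef -sumrB; apply: eq_bigr => j _.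
  by rewrite -mulrBr /ffact_diff rmorphB /= !rmorph_nat.
have d0 : 0 < ffact_diff R n m j0.
  by case: (j0) j0k jn => // j' _ jn; apply: ffact_diff_gt0.
have nj : 0 <= n%:R - j0%:R :> R by rewrite subr_ge0 ler_nat.
have memj : j0 \in index_iota 1 k.+1 by rewrite mem_index_iota ltnS.
move: D0; rewrite (bigD1_seq j0) ?iota_uniq //= => /eqP.
rewrite addr_eq0 => /eqP /(congr1 (@normc R)).
rewrite normcN ComplexField.Normc.normcM normc_real ?(ltW d0) // => D1.
suff : (n%:R - j0%:R) * (normc (Q j0)`_j0 * ffact_diff R n m j0) <=
    (\sum_(1 <= j < k.+1) normc (Q j)`_j) * ffact_diff R n m j0.
  by rewrite mulrA ler_pM2r // leNgt Ln.
rewrite D1 mulr_suml.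
apply: le_trans (ler_wpM2l nj (normc_sum _ _ _ _ _)) _.
rewrite mulr_sumr [leRHS](bigID (fun j => j != j0)) /= -[leLHS]addr0.
rewrite lerD //; last first.
  by apply: sumr_ge0 => j _; rewrite mulr_ge0 ?normc_ge0 ?ltW //.
rewrite big_nat_cond [leRHS]big_nat_cond; apply: ler_sum => j /andP[].
rewrite ltnS => jk jj0; have [jj|jj] := leqP j j0; last first.
  rewrite Qj ?mul0r ?ComplexField.Normc.normc0 ?mulr0 ?mul0r //.
  by rewrite jj; case/andP: jk.
rewrite ComplexField.Normc.normcM.
have jlt : (j < j0)%N by rewrite ltn_neqAle jj0.
have dj : 0 < ffact_diff R n m j.
  by case: (j) jk jlt => // j' _ jlt; apply: ffact_diff_gt0 => //; lia.
rewrite normc_real ?(ltW dj) // mulrCA ler_wpM2l ?normc_ge0 //.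
by apply: ffact_diff_dominates => //; case/andP: jk.
Qed.

(** * Linear lower bound for the root radius *)

Lemma root_le_root_radius (R : realType) (p : {poly R[i]}) (a : R[i]) :
  p != 0 -> root p a -> normc a <= root_radius p.
Proof.
move=> p0 pa; apply: ub_le_sup; last by exists a.
have [s pE] := closed_field_poly_normal p.
(* [sup] needs a bounded set; the sum of all root moduli is an upper bound. *)
exists (\sum_(b <- s) normc b) => _ [b pb <-].
have sb : b \in s.
  by move: pb; rewrite /= pE rootZ ?lead_coef_eq0 // root_prod_XsubC.
rewrite (big_rem b) //= lerDl; apply: sumr_ge0 => c _; exact: normc_ge0.
Qed.

Lemma diag_coef_le (R : realType) (k : nat) (Q : nat -> {poly R[i]})
  (d n : nat) :
  (forall j, (d < j <= k)%N -> (Q j)`_j = 0) -> (0 < n)%N ->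
  normc (diag_coef R k Q n) <=
    (\sum_(1 <= j < k.+1) normc (Q j)`_j) * n%:R ^+ d.
Proof.
move=> Qd n0; rewrite mulr_suml; apply: le_trans (normc_sum _ _ _ _ _) _.
rewrite big_nat_cond [leRHS]big_nat_cond; apply: ler_sum => j.
rewrite ltnS andbT => /andP[j0 jk].
rewrite ComplexField.Normc.normcM normc_nat.
have [jd|dj] := leqP j d; last first.
  by rewrite Qd ?dj // ComplexField.Normc.normc0 !mul0r.
rewrite ler_wpM2l ?normc_ge0 // -natrX ler_nat.
apply: (@leq_trans (n ^ j)); last by rewrite leq_pexp2l.
elim: (j) => // i IH; rewrite ffactnSr expnSr leq_mul //; exact: leq_subr.
Qed.

Lemma root_radius_linear_bound (R : realType) (k d : nat)
  (Q : nat -> {poly R[i]}) (L : R) :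
  (d < k)%N -> (forall j, (1 <= j <= k)%N -> (size (Q j) <= d.+1)%N) ->
  size (Q k) = d.+1 -> 0 <= L ->
  exists2 c : R, 0 < c & \forall n \near \oo, forall l p,
    is_eigenpoly k Q n l p -> normc l <= L * n%:R ^+ d ->
    c * n%:R <= root_radius p.
Proof.
move=> dk Qd Qk L0.
have [M M1 QkM] := horner_ge_lead_coef R (Q k) d Qk.
set a := normc (lead_coef (Q k)) / 2 in QkM.
have a0 : 0 < a.
  by rewrite divr_gt0 // lt_def normc_eq0 normc_ge0 lead_coef_eq0
    -size_poly_eq0 Qk.
pose A := \sum_(1 <= j < k) coef_norm R (Q j).
have A0 : 0 <= A by apply: sumr_ge0 => j _; exact: coef_norm_ge0.
(* [L * 3 ^+ d] comes from the eigenvalue term, through [n = 3 * rho / e]; [A] comes from the terms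
   of order below [k]. *)
pose B := L * 3 ^+ d + A.
have B0 : 0 <= B by rewrite addr_ge0 // mulr_ge0 // exprn_ge0.
(* Chosen so that [e <= 1] and [e * B < a]. *)
pose e := a / (a + B + 1).
have e0 : 0 < e by rewrite divr_gt0 //; lra.
have e1 : e <= 1 by rewrite ler_pdivrMr ?mul1r; lra.
have eB : e * B < a by rewrite mulrAC ltr_pdivrMr; nra.
(* The supposed root bound [r] is then half the test radius [rho = e * n / 3]. *)
exists (e / 6); first lra.
near=> n => l p [_ pn pE] ln.
(* This makes [|z| + r = e * n / 2] at most [e * (n - k)]. *)
have kn2 : (2 * k < n)%N by near: n; exact: nbhs_infty_gt.
have kn : (k < n)%N by rewrite (leq_ltn_trans _ kn2) // leq_pmull.
have Mn : M <= e * n%:R / 3.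
  suff : 3 * M / e <= n%:R by rewrite ler_pdivrMr // => H; lra.
  by near: n; exact: nbhs_infty_ger.
rewrite leNgt; apply/negP => rn.
pose rho := e * n%:R / 3; rewrite -/rho in Mn.
have rho1 : 1 <= rho by lra.
pose r := e / 6 * n%:R; rewrite -/r in rn.
have rE : r = rho / 2 by rewrite /r /rho; lra.
have p0 : p != 0 by rewrite -size_poly_eq0 pn.
have pr b : root p b -> normc b <= r.
  by move=> pb; apply: ltW (le_lt_trans (root_le_root_radius _ _ _ p0 pb) rn).
pose z : R[i] := (rho%:C)%C.
have zE : normc z = rho by rewrite normc_real //; lra.
have rz : r < normc z by rewrite zE; lra.
have zr : normc z + r <= e * (n - k)%:R.
  have nk : (k <= n)%N by exact: ltnW.
  have : 2 * k%:R <= n%:R :> R by rewrite -natrM ler_nat ltnW.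
  rewrite zE rE natrB // -subr_ge0 => /(mulr_ge0 (ltW e0)).
  rewrite /rho !mulrBr [e * (2 * _)]mulrCA.
  by move: (e * n%:R) (e * k%:R) => u v; lra.
have r0 : 0 <= r by lra.
set P := normc p^`(k).[z].
have pj j : (j <= k)%N -> normc p^`(j).[z] <= e ^+ (k - j) * P.
  by move=> jk; apply: derivn_geometric_bound r0 pr rz pn kn jk zr.
(* [z] lies outside the root disc, so [p] does not vanish there, and [pj] at 0 forces [P] to be
   positive. *)
have P0 : 0 < P.
  rewrite -(@pmulr_rgt0 _ (e ^+ k)) ?exprn_gt0 //.
  have := pj 0%N (leq0n k); rewrite subn0; apply: lt_le_trans.
  rewrite lt_def normc_ge0 andbT normc_eq0; apply: contraL rz => pz.
  by rewrite -leNgt pr.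
have rd0 : 0 < rho ^+ d by rewrite exprn_gt0 //; lra.
have eqn : (Q k).[z] * p^`(k).[z] =
    l * p.[z] - \sum_(1 <= j < k) (Q j).[z] * p^`(j).[z].
  have := congr1 (fun q : {poly R[i]} => q.[z]) pE.
  rewrite /diffop big_nat_recr /=; last exact: leq_ltn_trans dk.
  rewrite hornerD hornerZ hornerM horner_sum => <-.
  under [X in _ = X + _ - _]eq_bigr do rewrite hornerM.
  by rewrite [_ + (Q k).[z] * _]addrC addrK.
have up : a * rho ^+ d * P <= normc l * normc p.[z] +
    \sum_(1 <= j < k) normc (Q j).[z] * normc p^`(j).[z].
  apply: (@le_trans _ _ (normc ((Q k).[z] * p^`(k).[z]))).
    by rewrite ComplexField.Normc.normcM ler_wpM2r ?normc_ge0 // -zE QkM // zE.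
  rewrite eqn; apply: le_trans (le_normcD _ _) _.
  rewrite normcN ComplexField.Normc.normcM lerD2l.
  apply: le_trans (normc_sum _ _ _ _ _) _.
  by under eq_bigr do rewrite ComplexField.Normc.normcM.
have e_le i : (0 < i)%N -> e ^+ i <= e.
  by case: i => // i _; rewrite -[leRHS]expr1 ler_wiXn2l // ltW.
(* Substituting for [n] turns [n ^+ d * e ^+ k] into [(3 * rho) ^+ d * e ^+ (k - d)]; since [d < k],
   a factor [e] survives. *)
have lp : normc l * normc p.[z] <= L * 3 ^+ d * e * (rho ^+ d * P).
  have := pj 0%N (leq0n k); rewrite subn0 derivn0 => p_le.
  apply: le_trans (ler_pM (normc_ge0 _ _) (normc_ge0 _ _) ln p_le) _.
  have -> : n%:R = 3 * rho / e :> R by rewrite /rho; field; rewrite gt_eqF.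
  have -> : L * (3 * rho / e) ^+ d * (e ^+ k * P) =
      L * 3 ^+ d * e ^+ (k - d) * (rho ^+ d * P).
    rewrite -{1}(subnK (ltnW dk)) exprD expr_div_n exprMn.
    by field; rewrite expf_neq0 // gt_eqF.
  rewrite ler_pM2r ?mulr_gt0 // ler_wpM2l //; first by rewrite mulr_ge0.
  by rewrite e_le // subn_gt0.
have Ap : \sum_(1 <= j < k) normc (Q j).[z] * normc p^`(j).[z] <=
    A * e * (rho ^+ d * P).
  rewrite -mulrA mulr_suml big_nat_cond [leRHS]big_nat_cond.
  apply: ler_sum => j; rewrite andbT => /andP[j0 jk].
  have q_le : normc (Q j).[z] <= coef_norm R (Q j) * rho ^+ d.
    by rewrite -zE horner_le_coef_norm ?zE // Qd // j0 ltnW.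
  have p_le : normc p^`(j).[z] <= e * P.
    apply: le_trans (pj j (ltnW jk)) _; rewrite ler_pM2r //.
    by rewrite e_le // subn_gt0.
  apply: le_trans (ler_pM (normc_ge0 _ _) (normc_ge0 _ _) q_le p_le) _.
  by rewrite le_eqVlt; apply/orP; left; apply/eqP; ring.
(* Cancelling [rho ^+ d * P] leaves [a <= e * B], against the choice of [e]. *)
have : a * (rho ^+ d * P) <= e * B * (rho ^+ d * P).
  rewrite /B; move: up lp Ap; rewrite -mulrA; lra.
by rewrite ler_pM2r ?mulr_gt0 // leNgt eB.
Unshelve. all: by end_near.
Qed.

(** * Passage to the limit *)

Lemma linear_div_powR_cvg (R : realType) (u : nat -> R) (c gamma : R) :
  0 < c -> gamma < 1 -> (\forall n \near \oo, c * n%:R <= u n) ->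
  u n / (n%:R `^ gamma) @[n --> \oo] --> +oo.
Proof.
move=> c0 g1 cu; apply/cvgryPge => A; near=> n.
have n1 : 1 <= n%:R :> R by rewrite ler1n; near: n; exact: nbhs_infty_gt.
have n0 : 0 < n%:R :> R by lra.
rewrite ler_pdivlMr ?powR_gt0 //.
apply: (@le_trans _ _ (c * n%:R)); last by near: n.
rewrite -ler_pdivlMr ?powR_gt0 // -mulrA -powRN.
have -> : n%:R * n%:R `^ (- gamma) = n%:R `^ (1 - gamma) :> R.
  by rewrite powRD ?powRr1 ?(ltW n0) // (gt_eqF n0) implybT.
have g0 : 0 < 1 - gamma by lra.
(* The maximum with 0 makes [B] a power of its own root, so that [n >= B ^ (1 / (1 - gamma))]
   suffices. *)
pose B := Num.max 0 (A / c).
have B0 : 0 <= B by rewrite le_max lexx.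
rewrite mulrC -ler_pdivrMr //; apply: (@le_trans _ _ B).
  by rewrite le_max lexx orbT.
have -> : B = (B `^ (1 - gamma)^-1) `^ (1 - gamma).
  by rewrite -powRrM mulVf ?powRr1 // gt_eqF.
apply: ge0_ler_powR; rewrite ?nnegrE ?powR_ge0 ?(ltW g0) ?(ltW n0) //.
by near: n; exact: nbhs_infty_ger.
Unshelve. all: by end_near.
Qed.

Theorem corollary1 (R : realType) (k : nat) (Q : nat -> {poly R[i]}) (j0 : nat)
  (HT : degenerate_exactly_solvable k Q)
  (Hj0 : is_largest_full_degree k Q j0)
  (Hdeg : forall j : nat, (j0 < j <= k)%N -> (size (Q j) <= j0.+1)%N)
  (Hk : size (Q k) = j0.+1)
  (gamma : R) (Hgamma : gamma < 1) :
  largest_root_modulus k Q n / (n%:R `^ gamma) @[n --> \oo] --> +oo.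
Proof.
case: HT => Qk0 Qj _ Qkk; case: Hj0 => j0k Qj0 _.
have j0k' : (j0 < k)%N by rewrite -Hk.
have Qd j : (1 <= j <= k)%N -> (size (Q j) <= j0.+1)%N.
  move=> jk; have [jj|jj] := ltnP j0 j.
    by rewrite Hdeg // jj; case/andP: jk.
  exact: leq_trans (Qj j jk) _.
have Qz j : (j0 < j <= k)%N -> (Q j)`_j = 0.
  move=> jk; rewrite nth_default //; apply: leq_trans (Hdeg j jk) _.
  by case/andP: jk.
pose L := \sum_(1 <= j < k.+1) normc (Q j)`_j.
have L0 : 0 <= L by apply: sumr_ge0 => j _; exact: normc_ge0.
have [c c0 cn] := root_radius_linear_bound R k j0 Q L j0k' Qd Hk L0.
apply: linear_div_powR_cvg c0 Hgamma _; near=> n.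
have nj0 : (j0 <= n)%N by near: n; exact: nbhs_infty_ge.
have n0 : (0 < n)%N by near: n; exact: nbhs_infty_gt.
have q0 : 0 < normc (Q j0)`_j0.
  rewrite lt_def normc_ge0 andbT normc_eq0.
  have : lead_coef (Q j0) != 0 by rewrite lead_coef_eq0 -size_poly_eq0 Qj0.
  by rewrite lead_coefE Qj0.
(* Holds once [n] exceeds [j0] plus [L] divided by the modulus of the leading coefficient of
   [Q j0]. *)
have Ln : L < (n%:R - j0%:R) * normc (Q j0)`_j0.
  rewrite -ltr_pdivrMr // ltrBrDr.
  by near: n; exact: nbhs_infty_gtr.
have ex := eigenpoly_exists R k Q n Qj
  (fun m => diag_coef_neq R k Q j0 n m j0k Qz nj0 Ln).
(* Existence rules out the default 0: the polynomial selected by [xget] is an eigenpolynomial, so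
   the uniform bound applies to it. *)
have [l Hl] := xgetPex 0 ex.
have cn' : forall l p, is_eigenpoly k Q n l p -> normc l <= L * n%:R ^+ j0 ->
    c * n%:R <= root_radius p by near: n.
apply: (cn' _ _ Hl); rewrite (eigenvalueE _ _ _ _ _ _ Qj Hl).
exact: diag_coef_le.
Unshelve. all: by end_near.
Qed.
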